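(* Let $\mathcal{C}\subset \mathbb{Z}_9^4$ be the classical single-error-correcting code in the $9^4$ hypercubic lattice, i.e. the subgroup of $\mathbb{Z}_9^4$ generated by the vectors $(0,0,1,6)$, $(0,1,1,1)$ and $(1,0,0,2)$ modulo $9$ (its elements are the $729$ codewords). Then $\mathcal{C}$ can be characterized as a lattice code: there is a lattice $\Lambda$ with $\mathbb{Z}^4\supset \Lambda\supset 9\mathbb{Z}^4$ such that reduction of coordinates modulo $9$ induces a group isomorphism from the lattice code $\Lambda/9\mathbb{Z}^4$ onto $\mathcal{C}$.
   Context: $\mathbb{Z}_9=\mathbb{Z}/9\mathbb{Z}$. The $9^4$ hypercubic lattice is $\mathbb{Z}_9^4$, whose points correspond to the unit hypercubes of a $9\times9\times9\times9$ hypercube with opposite hyperfaces identified. An $n$-dimensional lattice is the set of all integer combinations of a basis of $\mathbb{R}^n$. If $\Lambda'\subset\Lambda$ are $n$-dimensional lattices, the set of cosets of $\Lambda'$ in $\Lambda$ (the quotient group $\Lambda/\Lambda'$) is called a lattice code. *)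

(* Defs.v *)
From HB Require Import structures.
From mathcomp Require Import all_boot all_order all_algebra all_fingroup.
From mathcomp Require Import boolp reals.

Set Implicit Arguments.
Unset Strict Implicit.
Unset Printing Implicit Defensive.

Import Order.TTheory GRing.Theory Num.Theory.
Local Open Scope ring_scope.

(* R^n is 'rV[R]_n. *)
Record lattice (R : realType) (n : nat) := Lattice {
  lattice_basis : n.-tuple 'rV[R]_n;
  lattice_basisP : basis_of fullv lattice_basis }.

Definition points (R : realType) (n : nat) (L : lattice R n) : {pred 'rV[R]_n} :=
  fun x => `[< exists z : 'I_n -> int,
                 x = \sum_(i < n) tnth (lattice_basis L) i *~ z i >].

Lemma points_zmod_closed (R : realType) (n : nat) (L : lattice R n) :
  zmod_closed (points L).
Proof.
split=> [|x y /asboolP[z ->] /asboolP[t ->]]; apply/asboolP.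
  by exists (fun=> 0); rewrite big1 // => i _; rewrite mulr0z.
exists (fun i => z i - t i); rewrite -sumrB.
by apply: eq_bigr => i _; rewrite mulrzBr.
Qed.

HB.instance Definition _ (R : realType) (n : nat) (L : lattice R n) :=
  GRing.isZmodClosed.Build 'rV[R]_n (points L) (points_zmod_closed L).

(* The abelian group carried by a lattice. *)
Record lattice_point (R : realType) (n : nat) (L : lattice R n) := LatticePoint {
  point_val :> 'rV[R]_n;
  point_valP : point_val \in points L }.

HB.instance Definition _ (R : realType) (n : nat) (L : lattice R n) :=
  [isSub for @point_val R n L].
HB.instance Definition _ (R : realType) (n : nat) (L : lattice R n) :=
  [Choice of lattice_point L by <:].
HB.instance Definition _ (R : realType) (n : nat) (L : lattice R n) :=
  [SubChoice_isSubZmodule of lattice_point L by <:].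

Definition sublattice_pred (R : realType) (n : nat) (L L' : lattice R n) :
  {pred lattice_point L} := fun x => point_val x \in points L'.

Lemma sublattice_zmod_closed (R : realType) (n : nat) (L L' : lattice R n) :
  zmod_closed (sublattice_pred (L := L) L').
Proof.
split; first exact: (rpred0 (points L')).
by move=> x y xL' yL'; apply: (@rpredB _ (points L')).
Qed.

HB.instance Definition _ (R : realType) (n : nat) (L L' : lattice R n) :=
  GRing.isZmodClosed.Build (lattice_point L) (sublattice_pred L')
    (sublattice_zmod_closed L L').

(* The quotient group L / L'. It is a lattice code only when L' is contained
   in L; without this inclusion the definition gives L / (L :&: L'). *)
Notation lattice_code L L' := (Quotient.quot (sublattice_pred (L := L) L')).

Lemma cubic_basisP (R : realType) (n m : nat) : (0 < m)%N ->
  basis_of fullv [tuple (delta_mx 0 i : 'rV[R]_n) *+ m | i < n].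
Proof.
move=> m_gt0; rewrite basisEdim size_tuple dimvf /dim /= mul1n leqnn andbT.
apply/subvP => x _; rewrite (row_sum_delta x); apply: memv_suml => i _.
have mR : (m%:R : R) != 0 by rewrite pnatr_eq0 -lt0n.
rewrite -[x 0 i](mulfVK mR) -scalerA rpredZ // scaler_nat memv_span //.
by apply/mapP; exists i; rewrite ?mem_enum.
Qed.

(* The lattice m Z^n. *)
Definition cubic_lattice (R : realType) (n m : nat) (m_gt0 : (0 < m)%N) :=
  Lattice (cubic_basisP R n m_gt0).

Definition Z4 (R : realType) : lattice R 4 := cubic_lattice R 4 (isT : (0 < 1)%N).
Definition nineZ4 (R : realType) : lattice R 4 := cubic_lattice R 4 (isT : (0 < 9)%N).

Definition vec4 (s : seq 'Z_9) : 'rV['Z_9]_4 := \row_(j < 4) s`_j.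

Definition generators : {set 'rV['Z_9]_4} :=
  [set vec4 [:: 0; 0; 1; 6]; vec4 [:: 0; 1; 1; 1]; vec4 [:: 1; 0; 0; 2]].

(* The group law of the finite group 'rV['Z_9]_4 is vector addition. *)
Definition code : {group 'rV['Z_9]_4} := <<generators>>%G.

(* Main.v *)
Require Import Defs.
From HB Require Import structures.
From mathcomp Require Import all_boot all_order all_algebra all_fingroup.
From mathcomp Require Import boolp reals.

Set Implicit Arguments.
Unset Strict Implicit.
Unset Printing Implicit Defensive.

Import Order.TTheory GRing.Theory Num.Theory.
Local Open Scope ring_scope.
Local Open Scope quotient_scope.

(* Modulo 9 the generators reduce to the systematic form [I | h] with
   h = (2, 4, 6), so a codeword is an arbitrary u in Z_9^3 followed by u h; this
   gives 9^3 codewords.  The preimage of the code in Z^4 is the lattice spanned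
   by the rows of the block matrix [[I, h], [0, 9]], and reduction modulo 9
   restricted to this preimage is onto the code with kernel 9 Z^4. *)

(** * Lattice points in integer coordinates, and divisibility by p *)

Lemma row_basisP (R : realType) n (B : 'M[R]_n) :
  B \in unitmx -> basis_of fullv [tuple row i B | i < n].
Proof.
move=> Bu; rewrite basisEdim size_tuple dimvf /dim /= mul1n leqnn andbT.
apply/subvP => x _; rewrite -(mulmxKV Bu x) mulmx_sum_row.
apply: memv_suml => i _; rewrite rpredZ // memv_span //.
by apply/mapP; exists i; rewrite ?mem_enum.
Qed.

Definition row_lattice (R : realType) n (B : 'M[R]_n) (Bu : B \in unitmx) :=
  Lattice (row_basisP Bu).

Lemma row_latticeP (R : realType) n (B : 'M[int]_n)
    (Bu : map_mx intr B \in unitmx) (x : 'rV[R]_n) :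
  reflect (exists z : 'rV_n, x = map_mx intr (z *m B))
          (x \in points (row_lattice Bu)).
Proof.
have E (z : 'rV_n) : map_mx intr (z *m B)
    = \sum_(i < n) tnth (lattice_basis (row_lattice Bu)) i *~ z 0 i.
  rewrite map_mxM mulmx_sum_row; apply: eq_bigr => i _.
  by rewrite tnth_mktuple mxE scaler_int.
apply: (iffP (asboolP _)) => [[z ->] | [z ->]]; last by exists (z 0).
exists (\row_i z i); rewrite E.
by apply: eq_bigr => i _; rewrite mxE.
Qed.

Lemma cubic_latticeP (R : realType) n m (m_gt0 : (0 < m)%N) (x : 'rV[R]_n) :
  reflect (exists z : 'rV_n, x = map_mx intr (z *+ m))
          (x \in points (cubic_lattice R n m_gt0)).
Proof.
have E (z : 'rV_n) : map_mx intr (z *+ m)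
    = \sum_(i < n) tnth (lattice_basis (cubic_lattice R n m_gt0)) i *~ z 0 i.
  rewrite [LHS]row_sum_delta; apply: eq_bigr => i _.
  rewrite tnth_mktuple mxE mulmxnE rmorphMn /= -[RHS]scaler_int.
  by rewrite -scalerMnl scalerMnr.
apply: (iffP (asboolP _)) => [[z ->] | [z ->]]; last by exists (z 0).
exists (\row_i z i); rewrite E.
by apply: eq_bigr => i _; rewrite mxE.
Qed.

(** Divide each entry by [p]: its class in ['Z_p] is that of the remainder, which lies below [p] and
    so must be 0. The bound on [p] matters because ['Z_0] and ['Z_1] are both Z/2. *)
Lemma mx_Zp_eq0 (p m n : nat) (z : 'M[int]_(m, n)) : (1 < p)%N ->
  reflect (exists y, z = y *+ p) (map_mx intr z == 0 :> 'M['Z_p]_(m, n)).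
Proof.
move=> p_gt1; apply: (iffP eqP) => [z0 | [y ->]]; last first.
  by apply/matrixP => i j; rewrite !mxE mulmxnE rmorphMn /=
     -mulr_natr pchar_Zp // mulr0.
exists (\matrix_(i, j) (z i j %/ p)%Z); apply/matrixP => i j.
rewrite mulmxnE mxE -mulr_natr [LHS](divz_eq _ p) natz.
have [k Ek] : exists k : nat, (z i j %% p)%Z = k.
  have : 0 <= (z i j %% p)%Z by rewrite modz_ge0 //; case: (p) p_gt1.
  by case: (_ %% _)%Z => // k _; exists k.
have k_lt : (k < p)%N.
  by rewrite -ltz_nat -Ek ltz_mod //; case: (p) p_gt1.
have k0 : k = 0%N.
  move/matrixP/(_ i j): z0; rewrite !mxE (divz_eq (z i j) p) Ek.
  rewrite intrD intrM -!pmulrn pchar_Zp // mulr0 add0r.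
  by move/(congr1 val); rewrite /= val_Zp_nat // modn_small.
by rewrite Ek k0 addr0.
Qed.

(** * The systematic encoder *)

(* The check column of the systematic form of the code, read off the generators
   [(1,0,0,2)], [(0,1,1,1) - (0,0,1,6) = (0,1,0,4)] and [(0,0,1,6)] mod 9. *)
Definition parity (A : pzRingType) : 'cV[A]_3 := \col_i [:: 2; 4; 6]`_i.

Lemma map_parity (A : pzRingType) : map_mx intr (parity int) = parity A.
Proof.
by apply/matrixP => i j; rewrite !mxE; case: i => [[|[|[|//]]]] /= _;
   rewrite ?rmorph_nat.
Qed.

Definition encode (A : pzRingType) (u : 'rV[A]_3) : 'rV[A]_(3 + 1) :=
  u *m row_mx 1%:M (parity A).

Lemma encodeE (A : pzRingType) (u : 'rV[A]_3) :
  encode u = row_mx u (u *m parity A).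
Proof. by rewrite /encode mul_mx_row mulmx1. Qed.

Lemma encode_inj (A : pzRingType) : injective (@encode A).
Proof. by move=> u v; rewrite !encodeE => /eq_row_mx[]. Qed.

Lemma map_encode (A : pzRingType) (u : 'rV[int]_3) :
  map_mx intr (encode u) = encode (map_mx intr u) :> 'rV[A]_(3 + 1).
Proof. by rewrite !encodeE map_row_mx map_mxM map_parity. Qed.

(** * The code as the image of the encoder *)

Lemma encode_group_set : group_set (@encode 'Z_9 @: [set: 'rV['Z_9]_3]).
Proof.
apply/group_setP; split=> [|_ _ /imsetP[u _ ->] /imsetP[v _ ->]].
  by apply/imsetP; exists 0; rewrite // /encode mul0mx.
by rewrite FinRing.zmodMgE /encode -mulmxDl; apply: imset_f.
Qed.

(** This expresses systematic codewords in the original generators. The second generator also adds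
    [b] to the third coordinate, hence the coefficient [c - b] on the last one. *)
Lemma vec4_encode (a b c : 'Z_9) :
  encode (\row_i [:: a; b; c]`_i) =
  a *: vec4 [:: 1; 0; 0; 2] + b *: vec4 [:: 0; 1; 1; 1]
    + (c - b) *: vec4 [:: 0; 0; 1; 6].
Proof.
rewrite encodeE; apply/rowP => i; case: (split_ordP i) => k ->.
  rewrite row_mxEl !mxE; case: k => [[|[|[|//]]] ?] /=;
    rewrite !(mulr0, mulr1, addr0, add0r) //.
  by rewrite addrC subrK.
rewrite row_mxEr !mxE !big_ord_recl big_ord0 !mxE [k]ord1 /=.
(* The check coordinates agree because 2a + b + 6(c - b) = 2a + (1 - 6)b + 6c. *)
have -> : 4 = 1 - 6 :> 'Z_9 by apply: val_inj.
by rewrite mulrBr mulrBl addr0 -!addrA [- _ + _]addrC.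
Qed.

Lemma codeE : code = @encode 'Z_9 @: [set: 'rV['Z_9]_3] :> {set 'rV['Z_9]_4}.
Proof.
apply/eqP; rewrite eqEsubset; apply/andP; split.
  rewrite (@gen_subG _ _ (Group encode_group_set)); apply/subsetP => w.
  rewrite !inE -orbA => /or3P[] /eqP->; apply/imsetP.
  - exists (\row_i [:: 0; 0; 1]`_i) => //.
    by rewrite vec4_encode subr0 !scale0r !add0r scale1r.
  - exists (\row_i [:: 0; 1; 1]`_i) => //.
    by rewrite vec4_encode subrr !scale0r add0r addr0 scale1r.
  exists (\row_i [:: 1; 0; 0]`_i) => //.
  by rewrite vec4_encode subrr !scale0r !addr0 scale1r.
apply/subsetP => _ /imsetP[u _ ->].
have -> : u = \row_i [:: u 0 0; u 0 1; u 0 2]`_i.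
  apply/rowP => i; rewrite mxE.
  by case: i => [[|[|[|//]]] ?] /=; congr (u 0 _); apply: val_inj.
(* Every scalar of ['Z_9] is the class of a natural number, so scaling is a power in the additive
   group and stays in the subgroup. *)
have gC v k : v \in generators -> k *: v \in code.
  move=> vg; rewrite -[k]natr_Zp scaler_nat -FinRing.zmodXgE.
  by rewrite groupX // mem_gen.
by rewrite vec4_encode -!FinRing.zmodMgE !groupM // gC // !inE eqxx ?orbT.
Qed.

Lemma card_code : #|code| = 729%N.
Proof.
rewrite codeE card_imset; last exact: encode_inj.
by rewrite cardsT card_mx card_ord.
Qed.

(** * The lattice over the code *)

Definition code_basis : 'M[int]_(3 + 1) := block_mx 1%:M (parity int) 0 9%:M.

(** The matrix is block triangular with determinant 9, nonzero in [R]. *)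
Lemma code_basis_unit (R : realType) :
  map_mx intr code_basis \in @unitmx R (3 + 1).
Proof.
rewrite unitmxE det_map_mx det_ublock det1 mul1r det_scalar expr1.
by rewrite unitfE rmorph_nat pnatr_eq0.
Qed.

Definition code_lattice (R : realType) : lattice R 4 :=
  row_lattice (code_basis_unit R).

Lemma code_latticeP (R : realType) (x : 'rV[R]_4) :
  reflect (exists2 z : 'rV_4, x = map_mx intr z & map_mx intr z \in code)
          (x \in points (code_lattice R)).
Proof.
have E (z : 'rV_(3 + 1)) : z *m code_basis =
    encode (lsubmx z) + row_mx 0 (rsubmx z *+ 9).
  rewrite -[z in LHS]hsubmxK mul_row_block mulmx1 mulmx0 addr0 encodeE.
  by rewrite add_row_mx addr0 mul_mx_scalar scaler_nat.
have mod9 (z : 'rV_(3 + 1)) :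
    map_mx intr (z *m code_basis) = encode (map_mx intr (lsubmx z))
    :> 'rV['Z_9]_(3 + 1).
  rewrite E map_mxD map_encode map_row_mx map_mx0.
  suff /eqP-> : map_mx intr (rsubmx z *+ 9) == 0 :> 'M['Z_9]_1.
    by rewrite row_mx0 addr0.
  by apply/mx_Zp_eq0 => //; exists (rsubmx z).
rewrite codeE; apply: (iffP (row_latticeP _ _)); last first.
  move=> [z -> /imsetP[u _ Eu]].
  set a := @lsubmx _ 1 3 1 z; set b := @rsubmx _ 1 3 1 z.
  (* Since z reduces to a codeword, its last coordinate [b] is congruent modulo 9 to the check value
     of [a]; the quotient [y] is the coefficient of the last basis row. *)
  have [y Ey]: exists y, b - a *m parity int = y *+ 9.
    apply/(@mx_Zp_eq0 9) => //; rewrite map_mxB map_mxM map_parity.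
    by rewrite map_lsubmx map_rsubmx Eu encodeE row_mxKl row_mxKr subrr.
  exists (row_mx a y); congr map_mx.
  rewrite E row_mxKl row_mxKr -Ey encodeE add_row_mx addr0 addrC subrK.
  by rewrite hsubmxK.
move=> [z ->]; exists (z *m code_basis) => //.
by apply/imsetP; exists (map_mx intr (@lsubmx _ 1 3 1 z)); rewrite ?mod9.
Qed.

(** The floor makes reduction total on R^n; it is exact on integer vectors. *)
Definition reduce (R : realType) n p (x : 'rV[R]_n) : 'rV['Z_p]_n :=
  map_mx (fun r => (Num.floor r)%:~R) x.

Lemma reduceE (R : realType) n p (z : 'rV[int]_n) :
  reduce p (map_mx intr z : 'rV[R]_n) = map_mx intr z.
Proof. by apply/rowP => i; rewrite !mxE intrKfloor. Qed.

Lemma point_valB (R : realType) n (L : lattice R n) (x y : lattice_point L) :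
  point_val (x - y) = point_val x - point_val y.
Proof. exact: (raddfB val). Qed.

(** * The map induced on the quotient by reduction modulo p *)

Section LatticeCode.
Variables (R : realType) (n p : nat) (p_gt1 : (1 < p)%N) (L : lattice R n).
Variable (p_gt0 : (0 < p)%N).
Hypothesis Lint : forall x, x \in points L -> exists z, x = map_mx intr z.
Local Notation pZ := (cubic_lattice R n p_gt0).

Definition code_map (c : lattice_code L pZ) :=
  reduce p (point_val (generic_quotient.repr c)).

(** Independence of the representative: the chosen one differs from [x] by a point of [pZ], and both
    are integral by [Lint], so their reductions agree. *)
Lemma code_map_pi (x : lattice_point L) (z : 'rV[int]_n) :
  point_val x = map_mx intr z ->
  code_map (\pi_(lattice_code L pZ) x) = map_mx intr z.
Proof.
move=> xz; rewrite /code_map; set y := generic_quotient.repr _.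
have [t yt] := Lint (point_valP y).
have /cubic_latticeP[k] : point_val (y - x) \in points pZ.
  suff : y - x \in sublattice_pred (L := L) pZ by [].
  by rewrite Quotient.idealrBE /y reprK.
rewrite point_valB xz yt -map_mxB /=.
move=> /(congr1 (@reduce R n p)); rewrite !reduceE => tz.
apply/eqP; rewrite -subr_eq0 -map_mxB /= tz.
by apply/mx_Zp_eq0 => //; exists k.
Qed.

Lemma code_map_zmod_morphism : zmod_morphism code_map.
Proof.
move=> a b; rewrite -[a]reprK -[b]reprK.
move: (generic_quotient.repr a) (generic_quotient.repr b) => x y.
have [s xs] := Lint (point_valP x); have [t yt] := Lint (point_valP y).
rewrite (code_map_pi xs) (code_map_pi yt) -map_mxB -raddfB.
by apply: code_map_pi; rewrite point_valB xs yt map_mxB.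
Qed.

Lemma code_map_inj : injective code_map.
Proof.
move=> a b; rewrite -[a]reprK -[b]reprK.
move: (generic_quotient.repr a) (generic_quotient.repr b) => x y.
have [s xs] := Lint (point_valP x); have [t yt] := Lint (point_valP y).
rewrite (code_map_pi xs) (code_map_pi yt) => /eqP.
rewrite -subr_eq0 -map_mxB => /(mx_Zp_eq0 _ p_gt1)[k Ek].
apply/eqP; rewrite -Quotient.idealrBE; apply/cubic_latticeP; exists k.
by rewrite point_valB xs yt -map_mxB -Ek.
Qed.

End LatticeCode.

Theorem theorem3 (R : realType) :
  #|code| = 729%N /\
  exists L : lattice R 4,
    [/\ {subset points L <= points (Z4 R)},
        {subset points (nineZ4 R) <= points L}
      & exists f : {additive lattice_code L (nineZ4 R) -> 'rV['Z_9]_4},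
          [/\ forall (x : lattice_point L) (z : 'rV[int]_4),
                point_val x = map_mx intr z ->
                f (\pi_(lattice_code L (nineZ4 R)) x) = map_mx intr z,
              injective f
            & forall w : 'rV['Z_9]_4, w \in code <-> exists c, f c = w]].
Proof.
split; first exact: card_code.
have Lint x : x \in points (code_lattice R) -> exists z, x = map_mx intr z.
  by move=> /code_latticeP[z -> _]; exists z.
exists (code_lattice R); split.
- by move=> x /Lint[z ->]; apply/cubic_latticeP; exists z.
- move=> x /cubic_latticeP[z ->]; apply/code_latticeP; exists (z *+ 9) => //.
  suff /eqP-> : map_mx intr (z *+ 9) == 0 :> 'rV['Z_9]_4.
    by rewrite -FinRing.zmod1gE group1.
  by apply/mx_Zp_eq0 => //; exists z.
have gt1 : (1 < 9)%N by [].
pose code_map9 : lattice_code (code_lattice R) (nineZ4 R) -> 'rV['Z_9]_4 :=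
  (* Here [isT] is the positivity proof inside [nineZ4], so the two quotients coincide by
     conversion. *)
  @code_map R 4 9 (code_lattice R) isT.
have fB : zmod_morphism code_map9 := code_map_zmod_morphism gt1 Lint.
pose fZ := GRing.isZmodMorphism.Build _ _ _ fB.
pose f : {additive _ -> _} := HB.pack code_map9 fZ.
exists f; split.
- by move=> x z xz; apply: code_map_pi.
- exact: code_map_inj.
move=> w; split=> [wC | [c <-]]; last first.
  rewrite -[c]reprK; move: (generic_quotient.repr c) => x.
  have /code_latticeP[z xz zC] := point_valP x.
  suff -> : f (\pi x) = map_mx intr z by []; exact: code_map_pi.
(* For surjectivity, lift [w] to its representatives in 0..8; the lift is a lattice point because it
   reduces to a codeword. *)
pose z : 'rV[int]_4 := map_mx (fun i : 'Z_9 => (i : nat)%:Z) w.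
have zw : map_mx intr z = w.
  by apply/rowP => i; rewrite !mxE -pmulrn natr_Zp.
have xL : map_mx intr z \in points (code_lattice R).
  by apply/code_latticeP; exists z; rewrite ?zw.
exists (\pi_(lattice_code _ (nineZ4 R)) (LatticePoint xL)); rewrite -zw.
exact: code_map_pi.
Qed.
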